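(* Let $k \ge 1$ and let $\mathcal{A}_k = (Q, \Sigma, \delta, Q_0, F)$ be a $k$-ambiguous nondeterministic Büchi automaton. Then $\mathrm{kdis}(\mathcal{A}_k)$ is an IBA, and for every $w \in \Sigma^\omega$ we have $L_{\mathrm{kdis}(\mathcal{A}_k)}(w) = 1$ if and only if $\mathcal{A}_k$ has a final path over $w$; i.e. $\mathrm{kdis}(\mathcal{A}_k)$ accepts the same language as $\mathcal{A}_k$.
   Context: An NBA $(Q,\Sigma,\delta,Q_0,F)$ has finite state set $Q$, alphabet $\Sigma$, transition relation $\delta : Q\times\Sigma \to 2^Q$, initial states $Q_0$, final states $F$. For $w = w_0w_1\ldots \in \Sigma^\omega$ a path is $q_0q_1\ldots$ with $q_0 \in Q_0$, $q_{i+1} \in \delta(q_i,w_i)$; it is final if some state of $F$ occurs infinitely often. The NBA accepts the words with at least one final path; it is $k$-ambiguous if every word has at most $k$ final paths. Weighted Büchi automata: $\mathcal{A} = (Q,\Sigma,M,\alpha,F)$ with $M:\Sigma\to\mathbb{Q}^{Q\times Q}$, $\alpha\in\mathbb{Q}^Q$, $F \subseteq Q$, $M(a_1\cdots a_m)=M(a_1)\cdots M(a_m)$. It is ultimately stable if for all $q,q'\in Q$, $a\in\Sigma$ such that $M(u)_{q',q}\ne 0$ for some $u\in\Sigma^*$, we have $M(a)_{q,q'}\in\{0,1\}$. A path over $w=w_0w_1\ldots$ is $q_0q_1\ldots$ with $\alpha(q_0)\ne0$ and $M(w_i)_{q_i,q_{i+1}}\ne0$ for all $i$; it is final if it visits $F$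 infinitely often. Its weight is $\alpha(q_0)\lim_{i\to\infty}\prod_{n\le i}M(w_n)_{q_n,q_{n+1}}$ (the limit exists by ultimate stability). For words with finitely many final paths, $L_\mathcal{A}(w)$ is the sum of the weights of the final paths. $\mathcal{A}$ is an IBA if it is ultimately stable, there is $N\in\mathbb{N}$ with at most $N$ final paths over every $w\in\Sigma^\omega$, and $L_\mathcal{A}(w)\in\{0,1\}$ for all $w\in\Sigma^\omega$; it accepts $\{w\mid L_\mathcal{A}(w)=1\}$. Construction $\mathrm{kdis}$. Let $\mathcal{B}=\{\bot,\top\}$ (false/true), $[k]=\{0,1,\ldots,k\}$, and for $\vec r\in[k]^{Q\times\mathcal{B}}$ let $\mathrm{size}(\vec r)=\sum_{(q,b)}\vec r_{q,b}$. Let $b''(\vec r)=\bot$ if $\vec r_{q,\bot}=0$ for all $q\in Q$, and $b''(\vec r)=\top$ otherwise. For $\vec r,\vec r'\in[k]^{Q\times\mathcal{B}}$ and $a\in\Sigma$, let $w(\vec r,a,\vec r')$ be the number of functions $f: Q\times\mathcal{B}\times\{1,\ldots,k\}\to 2^Q$ such that $f(q,b,i)=\emptyset$ if $i>\vec r_{q,b}$, $f(q,b,i)$ is a nonempty subset of $\delta(q,a)$ if $i\le\vec r_{q,b}$, and for every $(q',b')\in Q\times\mathcal{B}$ the number of triples $(q,b,i)$ with $q'\in f(q,b,i)$ and $b'=((q\in F)\vee b)\wedge b''(\vec r)$ equals $\vec r'_{q',b'}$. Define $\mathrm{kdis}'(\mathcal{A}_k)=(Q'',\Sigma,\Delta'',\alpha',F'')$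 with $Q''=[k]^{Q\times\mathcal{B}}\setminus\{\vec 0\}$; $\Delta''(a)_{\vec r,\vec r'}=(-1)^{\mathrm{size}(\vec r')-\mathrm{size}(\vec r)}w(\vec r,a,\vec r')$; $\alpha'_{\vec r}=(-1)^{\mathrm{size}(\vec r)-1}$ if $\vec r_{q,b}=0$ whenever $q\notin Q_0$ or $b=\top$, and $\vec r_{q,\bot}\le1$ for $q\in Q_0$, and $\alpha'_{\vec r}=0$ otherwise; $F''=\{\vec r\in Q''\mid \vec r_{q,\bot}=0\ \forall q\in Q\}$. $\mathrm{kdis}(\mathcal{A}_k)$ is $\mathrm{kdis}'(\mathcal{A}_k)$ restricted to those states that are reachable (from a state with nonzero $\alpha'$ via transitions of nonzero weight) and from which a cycle through a state of $F''$ can be reached. *)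

(* Defs.v *)
From HB Require Import structures.
From mathcomp Require Import all_boot all_order all_algebra.
Set Implicit Arguments. Unset Strict Implicit. Unset Printing Implicit Defensive.
Import Order.TTheory GRing.Theory Num.Theory.
Local Open Scope ring_scope.

Section NBA.
Variables (Q Sigma : finType) (delta : Q -> Sigma -> {set Q}) (Q0 F : {set Q}).

Definition nba_path (w : nat -> Sigma) (p : nat -> Q) : Prop :=
  p 0%N \in Q0 /\ forall i, p i.+1 \in delta (p i) (w i).

Definition inf_often {S : finType} (A : {set S}) (p : nat -> S) : Prop :=
  forall n, exists m, (n <= m)%N /\ p m \in A.

Definition nba_final_path (w : nat -> Sigma) (p : nat -> Q) : Prop :=
  nba_path w p /\ inf_often F p.

End NBA.

Definition at_most {T : Type} (N : nat) (P : T -> Prop) : Prop :=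
  forall f : 'I_N.+1 -> T, (forall i, P (f i)) -> exists i j, i != j /\ f i = f j.

Definition k_ambiguous (Q Sigma : finType) (delta : Q -> Sigma -> {set Q})
  (Q0 F : {set Q}) (k : nat) : Prop :=
  forall w : nat -> Sigma, at_most k (nba_final_path delta Q0 F w).

Section WBA.
Variables (S Sigma : finType) (M : Sigma -> S -> S -> rat) (alpha : S -> rat)
          (F : {set S}).

Definition mmul (A B : S -> S -> rat) : S -> S -> rat :=
  fun q q'' => \sum_(q' : S) A q q' * B q' q''.
Definition mid : S -> S -> rat := fun q q' => (q == q')%:R.

Definition Mword (u : seq Sigma) : S -> S -> rat :=
  foldr (fun a acc => mmul (M a) acc) mid u.

Definition ultimately_stable : Prop :=
  forall (q q' : S) (a : Sigma), (exists u : seq Sigma, Mword u q' q != 0) ->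
    M a q q' = 0 \/ M a q q' = 1.

Definition wpath (w : nat -> Sigma) (p : nat -> S) : Prop :=
  alpha (p 0%N) != 0 /\ forall i, M (w i) (p i) (p i.+1) != 0.

Definition wfinal_path (w : nat -> Sigma) (p : nat -> S) : Prop :=
  wpath w p /\ inf_often F p.

Definition cvg_rat (s : nat -> rat) (l : rat) : Prop :=
  forall eps : rat, 0 < eps -> exists N, forall n, (N <= n)%N -> `|s n - l| < eps.

Definition weight_is (w : nat -> Sigma) (p : nat -> S) (c : rat) : Prop :=
  exists l, cvg_rat (fun i => \prod_(n < i.+1) M (w n) (p n) (p n.+1)) l /\
            c = alpha (p 0%N) * l.

Definition L_is (w : nat -> Sigma) (v : rat) : Prop :=
  exists (n : nat) (ps : 'I_n -> nat -> S) (ws : 'I_n -> rat),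
    injective ps /\
    (forall i, wfinal_path w (ps i)) /\
    (forall p, wfinal_path w p -> exists i, ps i = p) /\
    (forall i, weight_is w (ps i) (ws i)) /\
    v = \sum_(i < n) ws i.

Definition IBA : Prop :=
  ultimately_stable /\
  (exists N : nat, forall w : nat -> Sigma, at_most N (wfinal_path w)) /\
  (forall w : nat -> Sigma, exists v, L_is w v /\ (v = 0 \/ v = 1)).

Definition wba_accepts (w : nat -> Sigma) : Prop := L_is w 1.

End WBA.

Section Kdis.
Variables (Q Sigma : finType) (delta : Q -> Sigma -> {set Q}) (Q0 F : {set Q})
          (k : nat).

(* vectors r in [k]^{Q x B}; bool: false = bot, true = top *)
Definition kvec : finType := {ffun Q * bool -> 'I_k.+1}.

Definition ksize (r : kvec) : nat := (\sum_(x : Q * bool) (r x : nat))%N.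

Definition bpp (r : kvec) : bool := [exists q : Q, (r (q, false) : nat) != 0%N].

(* index i : 'I_k stands for i+1 in {1,...,k} *)
Definition kfun_ok (r : kvec) (a : Sigma) (r' : kvec)
    (f : {ffun Q * bool * 'I_k -> {set Q}}) : bool :=
  [forall x : Q * bool * 'I_k,
     if (r x.1 <= x.2)%N (* i+1 > r_{q,b} *) then f x == set0
     else (f x != set0) && (f x \subset delta x.1.1 a)] &&
  [forall y : Q * bool,
     #|[set x : Q * bool * 'I_k |
          (y.1 \in f x) && (y.2 == ((x.1.1 \in F) || x.1.2) && bpp r)]|
     == (r' y : nat)].

Definition kweight (r : kvec) (a : Sigma) (r' : kvec) : nat :=
  #|[set f : {ffun Q * bool * 'I_k -> {set Q}} | kfun_ok r a r' f]|.

Definition Delta'' (a : Sigma) (r r' : kvec) : rat :=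
  (-1) ^ ((ksize r')%:Z - (ksize r)%:Z) * (kweight r a r')%:R.

Definition alpha' (r : kvec) : rat :=
  if [forall x : Q * bool, ((x.1 \notin Q0) || x.2) ==> ((r x : nat) == 0%N)] &&
     [forall q in Q0, (r (q, false) <= 1)%N]
  then (-1) ^ ((ksize r)%:Z - 1) else 0.

Definition kzero (r : kvec) : bool := [forall x, (r x : nat) == 0%N].

Definition inQ'' (r : kvec) : bool := ~~ kzero r.

Definition F'' (r : kvec) : bool := inQ'' r && [forall q : Q, (r (q, false) : nat) == 0%N].

Definition kedge : rel kvec :=
  fun r r' => [&& inQ'' r, inQ'' r' & [exists a : Sigma, Delta'' a r r' != 0]].

Definition kreachable (r : kvec) : bool :=
  inQ'' r && [exists r0 : kvec, [&& inQ'' r0, alpha' r0 != 0 & connect kedge r0 r]].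

Definition kcoreachable (r : kvec) : bool :=
  [exists f : kvec, [&& F'' f, connect kedge r f &
                       [exists g : kvec, kedge f g && connect kedge g f]]].

Definition kkeep (r : kvec) : bool := kreachable r && kcoreachable r.

Definition kstate : finType := {r : kvec | kkeep r}.

Definition kdis_M (a : Sigma) (s s' : kstate) : rat := Delta'' a (val s) (val s').
Definition kdis_alpha (s : kstate) : rat := alpha' (val s).
Definition kdis_F : {set kstate} := [set s : kstate | F'' (val s)].

End Kdis.

Arguments kdis_M {Q Sigma} delta Q0 F k a s s'.
Arguments kdis_alpha {Q Sigma} delta Q0 F k s.
Arguments kdis_F {Q Sigma} delta Q0 F k.

(* Main.v *)
Require Import Defs.
From mathcomp Require Import all_boot all_order all_algebra.
From mathcomp Require Import boolp.
Set Implicit Arguments. Unset Strict Implicit. Unset Printing Implicit Defensive.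
Import Order.TTheory GRing.Theory Num.Theory.

(** A word with m <= k final runs is accepted with weight
    - sum over nonempty sets S of final runs of (-1)^|S|, which is 1 for m > 0
    (inclusion-exclusion).  Recording, for every n, how many length-n histories
    of the runs in S end in each state with each breakpoint flag, sends S to one
    final path rho of kdis.  Conversely, the product of the counts w along the
    first n transitions of rho is the number of sets of n-step histories with
    these statistics; by a Koenig-type argument each of them is the set of
    n-step histories of some S mapped to rho, and S is determined by it once n
    separates the m runs.  So the weight of rho is the sum of -(-1)^|S| over the
    S mapped to rho.  Ultimate stability: a transition on a cycle keeps the size
    constant, and if its count w were at least 2, going around k+1 times before
    entering an accepting cycle would give a word with at least 2^(k+1) sets of
    final runs, while k-ambiguity allows at most 2^k. *)

(** * Finite enumerations, alternating sums and numbering of threads *)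

(** Take the largest m for which m distinct elements of [P] can be listed; an element missing from
    such a list would extend it. *)
Lemma at_most_enum (T : Type) (N : nat) (P : T -> Prop) :
  at_most N P -> exists m (f : 'I_m -> T),
    [/\ m <= N, injective f, forall i, P (f i) & forall x, P x -> exists i, f i = x].
Proof.
move=> PN; pose A m := `[< exists f : 'I_m -> T, injective f /\ forall i, P (f i) >].
have A0 : exists m, A m.
  by exists 0; apply/asboolP; exists (fun i : 'I_0 => False_rect T (notF (valP i))); split; case.
have Amax m : A m -> m <= N.
  move=> /asboolP[f [fI fP]]; rewrite leqNgt; apply/negP => ltNm.
  have [i [j [/negP + /fI/(congr1 val)/= eij]]] := PN _ (fun i => fP (widen_ord ltNm i)).
  by case; apply/eqP/val_inj.
case: (ex_maxnP A0 Amax) => m /[dup] Am /asboolP[f [fI fP]] mmax.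
exists m, f; split => // [|x Px]; first exact: Amax.
apply: contrapT => nx; suff /mmax : A m.+1 by rewrite ltnn.
apply/asboolP; exists (fun i => if unlift ord_max i is Some j then f j else x); split=> [i j|i].
  case: unliftP => [i'|] ->; case: unliftP => [j'|] -> //.
  - by move=> /fI->.
  - by move=> e; case: nx; exists i'.
  - by move=> e; case: nx; exists j'.
by case: unliftP.
Qed.

Lemma inf_often_point (S : finType) (A : {set S}) (p : nat -> S) :
  inf_often A p -> exists2 a, a \in A & inf_often [set a] p.
Proof.
move=> Ap; apply: contrapT => nA.
have bnd a : exists N, forall n, N <= n -> p n = a -> a \notin A.
  apply: contrapT => nN; apply: nA; exists a.
    apply: contrapT => /negP aA; apply: nN; by exists 0.
  move=> n; apply: contrapT => nm; apply: nN; exists n => m nm' pm.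
  by case: nm; exists m; rewrite pm inE eqxx.
have [N NP] := fin_all_exists bnd.
have [m [lem mA]] := Ap (\max_a N a).
by move: mA; apply/negP/(NP (p m) m) => //; exact: leq_trans (leq_bigmax _) lem.
Qed.

(** Expand the product of (-1) + 1 over the elements of [I]. *)
Lemma sum_signr_card (R : pzRingType) (I : finType) :
  (\sum_(S : {set I}) (-1) ^+ #|S| = (#|I| == 0)%:R :> R)%R.
Proof.
have -> : (\sum_(S : {set I}) (-1) ^+ #|S| = \prod_(i : I) ((-1) + 1) :> R)%R.
  rewrite bigA_distr; apply: eq_bigr => S _.
  by rewrite -big_mkcond /= prodr_const.
by rewrite addNr prodr_const expr0n.
Qed.

Lemma exprN1z_sub (a b : nat) :
  ((-1 : rat) ^ (a%:Z - b%:Z) = (-1) ^+ a * (-1) ^+ b)%R.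
Proof. by rewrite expfzDr // -exprnP -exprz_inv invrN1 -exprnP. Qed.

(** Numbers the threads of each key, turning them into the triples (q, b, i) on which the functions
    counted by [kweight] are nonempty. *)
Lemma indexed_threads (X K : finType) (T : {set X}) (key : X -> K) (r : K -> nat) k :
  0 < k -> (forall y, #|[set t in T | key t == y]| = r y) -> (forall y, r y <= k) ->
  exists h : X -> K * 'I_k,
    [/\ {in T &, injective h}, h @: T = [set x : K * 'I_k | x.2 < r x.1]
       & forall t, (h t).1 = key t].
Proof.
case: k => // k _ Tr rk.
pose cls y := enum [set t in T | key t == y].
have scls y : size (cls y) = r y by rewrite -cardE Tr.
have mcls t y : (t \in cls y) = (t \in T) && (key t == y) by rewrite mem_enum inE.
pose h t := (key t, inord (index t (cls (key t))) : 'I_k.+1).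
have hval t : t \in T -> (h t).2 = index t (cls (key t)) :> nat.
  move=> tT; rewrite inordK // (leq_trans _ (rk (key t))) // -scls index_mem.
  by rewrite mcls tT eqxx.
exists h; split=> // [t t' tT t'T /[dup] /(congr1 fst) /= ek /(congr1 (val \o snd)) /= |].
  rewrite -/(h t).2 -/(h t').2 !hval // -ek => ei.
  by rewrite -(nth_index t (_ : t \in cls (key t))) ?ei ?nth_index // mcls ?tT ?t'T ?ek eqxx.
apply/setP => -[y i]; rewrite inE; apply/imsetP/idP => [[t tT [-> ei]]|/= lti].
  rewrite ei -/(h t).2 hval //= -scls index_mem mcls tT eqxx //.
have /card_gt0P[t0 _] : 0 < #|[set t in T | key t == y]| by rewrite Tr (leq_ltn_trans _ lti).
have : nth t0 (cls y) i \in cls y by rewrite mem_nth ?scls.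
set t := nth _ _ _; rewrite mcls => /andP[tT /eqP kt]; exists t => //.
rewrite /h kt; congr pair; apply: val_inj; rewrite /= inordK index_uniq ?enum_uniq ?scls //.
Qed.

(** * Extending a set of threads by one transition *)

Lemma card_fibers (X K : finType) (T : {set X}) (key : X -> K) :
  \sum_y #|[set t in T | key t == y]| = #|T|.
Proof.
rewrite -sum1_card (partition_big key xpredT) //=; apply: eq_bigr => y _.
by rewrite -sum1_card; apply: eq_bigl => t; rewrite inE.
Qed.

Section Extensions.
Variables (Q Sigma : finType) (delta : Q -> Sigma -> {set Q}) (F : {set Q}) (k : nat).
Hypothesis k_gt0 : 0 < k.
Variables (X : finType) (st : X -> Q) (fl : X -> bool).

(** [T'] is the graph of a function counted by [kweight], with threads in place of triples; the
    first conjunct says that exactly the threads of [T] have successors, possibly several. *)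
Definition extends (a : Sigma) (T : {set X}) (r r' : kvec Q k) (T' : {set X * Q}) : bool :=
  [&& [set t.1 | t in T'] == T, [forall t in T', t.2 \in delta (st t.1) a] &
   [forall y, #|[set t in T' | (t.2, ((st t.1 \in F) || fl t.1) && bpp r) == y]| == r' y]].

(** Once the threads of [T] are numbered by h, a function f corresponds to the set [G f] of pairs
    (t, q) with q in f (h t). Counts agree because h preserves state and flag. *)
Lemma card_extends a (T : {set X}) (r r' : kvec Q k) :
  (forall y, #|[set t in T | (st t, fl t) == y]| = r y) ->
  #|[set T' | extends a T r r' T']| = kweight delta F r a r'.
Proof.
move=> Tr; have [|h [hI hT hk]] := indexed_threads k_gt0 Tr; first by move=> y; rewrite -ltnS.
pose G (f : {ffun Q * bool * 'I_k -> {set Q}}) := [set t : X * Q | (t.1 \in T) && (t.2 \in f (h t.1))].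
have hin x : (x \in h @: T) = (x.2 < r x.1) by rewrite hT inE.
have st_h t : st t = (h t).1.1 by rewrite hk.
have fl_h t : fl t = (h t).1.2 by rewrite hk.
have G_count (f : {ffun Q * bool * 'I_k -> {set Q}}) (r'' : kvec Q k) : (forall x, x \notin h @: T -> f x = set0) ->
    forall y, #|[set t in G f | (t.2, ((st t.1 \in F) || fl t.1) && bpp r'') == y]|
    = #|[set x : Q * bool * 'I_k | (y.1 \in f x) && (y.2 == ((x.1.1 \in F) || x.1.2) && bpp r'')]|.
  move=> f0 [q b]; rewrite -(card_in_imset (f := fun t : X * Q => h t.1)) /=; last first.
    move=> [t1 q1] [t2 q2]; rewrite !inE /= => /andP[/andP[t1T _] /eqP[e1 _]].
    by move=> /andP[/andP[t2T _] /eqP[e2 _]] /hI-> //; rewrite e1 e2.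
  apply: eq_card => x; rewrite inE; apply/imsetP/idP => [[[t q1] + ->]|/andP[qx bx]] /=.
    rewrite !inE /= => /andP[/andP[tT qf] /eqP[<- <-]].
    by rewrite qf st_h fl_h eqxx.
  have /imsetP[t tT ex] : x \in h @: T.
    by apply: contraLR qx => /f0->; rewrite inE.
  exists (t, q) => //; rewrite !inE /= tT -ex qx st_h fl_h -ex.
  by rewrite xpair_eqE eqxx eq_sym.
have ok0 f : kfun_ok delta F r a r' f -> forall x, x \notin h @: T -> f x = set0.
  move=> /andP[/forallP f1 _] x; rewrite hin -leqNgt => le.
  by have := f1 x; rewrite le => /eqP.
rewrite /kweight -(card_in_imset (f := G)); last first.
  move=> f g; rewrite !inE => fok gok eG; apply/ffunP => x.
  have [/imsetP[t tT ->]|nx] := boolP (x \in h @: T); last by rewrite (ok0 f) ?(ok0 g).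
  by apply/setP => q; move/setP: eG => /(_ (t, q)); rewrite !inE /= tT.
apply: eq_card => T'; rewrite inE; apply/idP/imsetP => [/and3P[/eqP T'T /forallP T'd /forallP T'c]|].
  pose f : {ffun Q * bool * 'I_k -> {set Q}} :=
    [ffun x => [set q | [exists t in T, (h t == x) && ((t, q) \in T')]]].
  have fh t q : t \in T -> (q \in f (h t)) = ((t, q) \in T').
    move=> tT; rewrite ffunE inE; apply/existsP/idP => [[t' /and3P[t'T /eqP/hI-> //]]|tq].
    by exists t; rewrite tT eqxx.
  have f0 x : x \notin h @: T -> f x = set0.
    move=> nx; apply/setP => q; rewrite ffunE !inE; apply/negbTE; apply: contra nx.
    by move=> /existsP[t /and3P[tT /eqP<- _]]; apply: imset_f.
  have GfT' : G f = T'.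
    apply/setP => -[t q]; rewrite inE /=; have [tT|nt] := boolP (t \in T); first by rewrite fh.
    apply/esym/negbTE; apply: contra nt => tq; rewrite -T'T.
    by apply/imsetP; exists (t, q).
  exists f => //; rewrite inE; apply/andP; split; last first.
    by apply/forallP => y; rewrite -(G_count f r) // GfT'; exact: T'c.
  apply/forallP => x; rewrite leqNgt -hin; case: ifPn => [/f0->//|/negbNE/imsetP[t tT ->]].
  apply/andP; split.
    move: (tT); rewrite -T'T => /imsetP[[t' q] tq /= et]; apply/set0Pn; exists q.
    by rewrite fh // et.
  apply/subsetP => q; rewrite fh // => tq; have := T'd (t, q); rewrite tq /=.
  by rewrite st_h.
move=> [f]; rewrite inE => fok ->; have f0 := ok0 f fok.
have /andP[/forallP f1 /forallP f2] := fok.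
have fT t : t \in T -> (f (h t) != set0) && (f (h t) \subset delta (st t) a).
  move=> tT; have := f1 (h t); rewrite leqNgt -hin (imset_f h tT) /= st_h //.
apply/and3P; split.
- apply/eqP/setP => t; apply/imsetP/idP => [[[t' q] + ->]|tT]; first by rewrite inE /= => /andP[].
  have /andP[/set0Pn[q qf] _] := fT t tT.
  by exists (t, q) => //; rewrite inE /= tT.
- apply/forallP => -[t q]; apply/implyP; rewrite inE /= => /andP[tT].
  by have /andP[_ /subsetP] := fT t tT; apply.
- by apply/forallP => y; rewrite G_count.
Qed.

End Extensions.

(** With the triples themselves as threads, a nonzero weight yields an extension, which projects
    onto the set of old threads. *)
Lemma ksize_le (Q Sigma : finType) (delta : Q -> Sigma -> {set Q}) (F : {set Q}) k
    (r r' : kvec Q k) a :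
  0 < k -> kweight delta F r a r' != 0 -> ksize r <= ksize r'.
Proof.
move=> k0; pose T := [set x : Q * bool * 'I_k | x.2 < r x.1].
have Tr y : #|[set t in T | (t.1.1, t.1.2) == y]| = r y.
  rewrite -[RHS]card_ord -[RHS](card_imset _ (f := fun i : 'I_(r y) => (y, widen_ord (leq_ord (r y)) i))).
    apply: eq_card => -[[q b] i]; rewrite !inE /=; apply/andP/imsetP => [[li /eqP e]|[j _ [-> ->]]].
      rewrite e in li; exists (Ordinal li) => //=; rewrite e; congr pair; exact: val_inj.
    by split; [exact: (ltn_ord j)|].
  by move=> i j [e]; apply: val_inj.
rewrite -(card_extends delta F k0 a r' Tr) cards_eq0 => /set0Pn[T'].
rewrite inE => /and3P[/eqP T'T _ /forallP T'r].
have -> : ksize r = #|T| by rewrite -(card_fibers T (fun t => (t.1.1, t.1.2))); apply: eq_bigr => y _; rewrite Tr.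
have -> : ksize r' = #|T'|.
  by rewrite -(card_fibers T' (fun t => (t.2, ((t.1.1.1 \in F) || t.1.1.2) && bpp r))); apply: eq_bigr => y _; apply/eqP; rewrite eq_sym; apply: T'r.
by rewrite -T'T; apply: leq_imset_card.
Qed.

(** * Sets of run histories *)

(** Lifts are chosen recursively above [a], and projections are taken below it; the induction on n
    shifts the system until [a] sits at level 0. *)
Lemma inverse_system_thread (A : nat -> Type) (pi : forall n, A n.+1 -> A n)
    (G : forall n, A n -> Prop) :
  (forall n a, G n a -> exists2 a', G n.+1 a' & pi n a' = a) ->
  (forall n a, G n.+1 a -> G n (pi n a)) ->
  forall n a, G n a -> exists x : forall n, A n,
    [/\ forall n, G n (x n), forall n, pi n (x n.+1) = x n & x n = a].
Proof.
move=> up down n; elim: n A pi G up down => [|n IHn] A pi G up down a Ga.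
  pose step n (y : {a | G n a}) : {a' | G n.+1 a' & pi n a' = sval y} :=
    cid2 (up n (sval y) (svalP y)).
  pose x := nat_rect (fun n => {a | G n a}) (exist _ a Ga)
    (fun n y => exist _ (s2val (step n y)) (s2valP (step n y))).
  exists (fun n => sval (x n)); split=> // j; first exact: svalP.
  exact: s2valP' (step j (x j)).
have [x [xG xpi xa]] := IHn _ _ (fun n => G n.+1) (fun n => up n.+1) (fun n => down n.+1) a Ga.
exists (fun j => if j is i.+1 then x i else pi 0 (x 0)).
by split=> // -[|j] //; apply: down.
Qed.

Section Histories.
Variables (Q Sigma : finType) (delta : Q -> Sigma -> {set Q}) (Q0 F : {set Q}) (k : nat).
Hypothesis k_gt0 : 0 < k.

(* [((q_0, q_1), ..., q_n)] *)
Fixpoint hist n : finType := if n is m.+1 then (hist m * Q)%type else Q.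

Definition tip n : hist n -> Q :=
  match n with 0 => fun t : hist 0 => t | m.+1 => fun t : hist m * Q => t.2 end.

Fixpoint hist_of (p : nat -> Q) n : hist n :=
  match n with 0 => p 0 | m.+1 => (hist_of p m, p m.+1) end.

(* [b m] stands for [bpp] of the m-th vector; it is abstract because that vector is itself
   defined by counting histories with their flags. *)
Fixpoint flag (b : nat -> bool) n : hist n -> bool :=
  match n with
  | 0 => fun=> false
  | m.+1 => fun t : hist m * Q => ((tip t.1 \in F) || flag b t.1) && b m
  end.

Lemma tip_hist_of p n : tip (hist_of p n) = p n.
Proof. by case: n. Qed.

Lemma hist_of_eq p p' n : hist_of p n = hist_of p' n -> forall j, j <= n -> p j = p' j.
Proof.
elim: n => [|n IHn] /= e j; first by rewrite leqn0 => /eqP->.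
case: e => /IHn{}IHn e; rewrite leq_eqVlt => /predU1P[->//|]; rewrite ltnS; exact: IHn.
Qed.

Lemma eq_flag b b' n : (forall j, j < n -> b j = b' j) -> @flag b n =1 @flag b' n.
Proof.
elim: n => [|n IHn] //= e t; rewrite e // IHn // => j jn; exact/e/ltnW.
Qed.

(** A flag turns from false to true only on leaving a state of [F]. *)
Lemma flag_visit b p m n : m <= n -> ~~ flag b (hist_of p m) -> flag b (hist_of p n) ->
  exists2 j, m <= j & p j \in F.
Proof.
move=> /subnKC <- fm; elim: (n - m) => [|d IHd]; first by rewrite addn0 (negbTE fm).
rewrite addnS /= tip_hist_of => /andP[/orP[pF|/IHd//] _].
by exists (m + d) => //; exact: leq_addr.
Qed.

Implicit Types (w : nat -> Sigma) (rho : nat -> kvec Q k).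

Definition counts b n (T : {set hist n}) (r : kvec Q k) : bool :=
  [forall y, #|[set t in T | (tip t, flag b t) == y]| == r y].

(** [T] is the set of leaves of a forest of run prefixes; the recursion imposes the statistics of
    [rho] on every level, not only on the last. *)
Fixpoint tree w rho n : {set hist n} -> bool :=
  match n with
  | 0 => fun T : {set hist 0} => (T \subset Q0) && counts (fun j => bpp (rho j)) T (rho 0)
  | m.+1 => fun T : {set hist m * Q} =>
      [&& tree w rho [set t.1 | t in T], [forall t in T, t.2 \in delta (tip t.1) (w m)]
        & counts (n := m.+1) (fun j => bpp (rho j)) T (rho m.+1)]
  end.

Lemma tree_counts w rho n (T : {set hist n}) :
  tree w rho T -> counts (fun j => bpp (rho j)) T (rho n).
Proof. by case: n T => [|n] T /= => [/andP[]|/and3P[]]. Qed.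

Lemma card_tree_ksize w rho n (T : {set hist n}) : tree w rho T -> #|T| = ksize (rho n).
Proof.
move=> /tree_counts/forallP Tr.
rewrite -(card_fibers T (fun t => (tip t, flag (fun j => bpp (rho j)) t))).
by apply: eq_bigr => y _; apply/eqP.
Qed.

Lemma extends_tree w rho n (T : {set hist n}) (T' : {set hist n.+1}) : tree w rho T ->
  extends delta F (@tip n) (flag (fun j => bpp (rho j)) (n := n)) (w n) T (rho n) (rho n.+1) T' =
  (tree w rho T' && ([set t.1 | t in T'] == T)).
Proof.
rewrite /extends [tree w rho T']/= => tT.
case: eqP => [->|_]; last by rewrite andbF.
by rewrite tT andbT.
Qed.

Lemma card_tree_step w rho n (T : {set hist n}) : tree w rho T ->
  #|[set T' : {set hist n.+1} | tree w rho T' && ([set t.1 | t in T'] == T)]|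
  = kweight delta F (rho n) (w n) (rho n.+1).
Proof.
move=> tT; rewrite -(card_extends delta F k_gt0 (w n) (rho n.+1) (T := T) (st := @tip n)
  (fl := flag (fun j => bpp (rho j)) (n := n))).
  by apply: eq_card => T'; rewrite !inE extends_tree.
by move=> y; apply/eqP; move/tree_counts/forallP: tT; apply.
Qed.

Lemma alpha'_tree0 w rho (T : {set hist 0}) : tree w rho T -> alpha' Q0 (rho 0) != 0%R.
Proof.
move=> /andP[/subsetP TQ0 /forallP/= Tr]; rewrite /alpha'.
suff -> : [forall x : Q * bool, ((x.1 \notin Q0) || x.2) ==> ((rho 0 x : nat) == 0%N)] &&
     [forall q in Q0, (rho 0 (q, false) <= 1)%N] by rewrite expfz_neq0.
apply/andP; split; apply/forallP.
  move=> -[q b]; apply/implyP => /= qb; rewrite -(eqP (Tr (q, b))) cards_eq0.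
  apply/eqP/setP => t; rewrite !inE xpair_eqE; apply/negbTE.
  apply: contraL qb => /and3P[/TQ0 tQ /eqP<- /eqP<-]; by rewrite tQ.
move=> q; apply/implyP => _; rewrite -(eqP (Tr (q, false))) -(cards1 q).
by apply/subset_leq_card/subsetP => t; rewrite !inE xpair_eqE => /and3P[].
Qed.

(** A vector with nonzero [alpha'] is the indicator of a subset of [Q0] with flag false, and that
    subset is the only candidate. *)
Lemma card_tree0 w rho : alpha' Q0 (rho 0) != 0%R -> #|[set T : {set hist 0} | tree w rho T]| = 1.
Proof.
rewrite /alpha'; case: ifP => [/andP[/forallP a1 /forallP a2] _|_]; last by rewrite eqxx.
pose T0 : {set hist 0} := [set q : Q | (rho 0 (q, false) : nat) != 0].
apply/eqP/cards1P; exists T0; apply/setP => T; rewrite !inE /=.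
have cq (S : {set hist 0}) q : #|[set t in S | (t, false) == (q, false)]| = (q \in S).
  case: (boolP (q \in S)) => qS; last first.
    apply/eqP; rewrite cards_eq0; apply/eqP/setP => t; rewrite !inE xpair_eqE andbT.
    by apply/negbTE; apply: contra qS => /andP[tS /eqP<-].
  apply/eqP/cards1P; exists q; apply/setP => t; rewrite !inE xpair_eqE andbT.
  by rewrite andbC; case: eqP => // ->.
apply/andP/eqP => [[_ /forallP Tr]|->].
  by apply/setP => q; rewrite inE -(eqP (Tr (q, false))) cq eqb0 negbK.
split; first by apply/subsetP => q; rewrite inE; apply: contraR => qQ; have := a1 (q, false); rewrite /= qQ.
apply/forallP => -[q []] /=.
  have := a1 (q, true); rewrite orbT /= => /eqP->.
  by rewrite cards_eq0; apply/eqP/setP => t; rewrite !inE xpair_eqE !andbF.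
rewrite cq inE; have := a2 q; have := a1 (q, false); rewrite /= orbF.
by case: (q \in Q0) => /= [_|/eqP-> //]; case: (nat_of_ord _) => [|[]].
Qed.

(** All trees of depth n have the same number of one-step extensions, so the step counts
    multiply. *)
Lemma card_tree w rho n : alpha' Q0 (rho 0) != 0%R ->
  #|[set T : {set hist n} | tree w rho T]|
  = \prod_(j < n) kweight delta F (rho j) (w j) (rho j.+1).
Proof.
move=> a0; elim: n => [|n IHn]; first by rewrite big_ord0 card_tree0.
rewrite big_ord_recr /= -IHn -sum_nat_const -sum1_card.
rewrite (partition_big (fun T' : {set hist n.+1} => [set t.1 | t in T'])
  (fun T => T \in [set T : {set hist n} | tree w rho T])) /=.
  apply: eq_bigr => T; rewrite inE => tT; rewrite -(card_tree_step tT) -sum1_card.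
  by apply: eq_bigl => T'; rewrite !inE.
by move=> T'; rewrite !inE /= => /andP[].
Qed.

(** The final paths of kdis' before trimming. Membership in Q'' is stated at time 0 and propagates,
    since sizes never decrease. *)
Definition kfinal w rho : Prop :=
  [/\ inQ'' (rho 0), alpha' Q0 (rho 0) != 0%R,
      forall i, kweight delta F (rho i) (w i) (rho i.+1) != 0
    & inf_often [set r | F'' r] rho].

Lemma inQ''_ksize (r : kvec Q k) : inQ'' r = (0 < ksize r).
Proof.
by rewrite /inQ'' /kzero lt0n /ksize sum_nat_eq0.
Qed.

Lemma kfinal_inQ'' w rho n : kfinal w rho -> inQ'' (rho n).
Proof.
case=> q0 _ kw _; elim: n => // n; rewrite !inQ''_ksize => /leq_trans; apply.
exact: ksize_le k_gt0 (kw n).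
Qed.

Lemma F''_flag b n (T : {set hist n}) (r : kvec Q k) t :
  F'' r -> counts b T r -> t \in T -> flag b t.
Proof.
move=> /andP[_ /forallP r0] /forallP Tr tT; apply: contraT => nf.
have := Tr (tip t, false); rewrite (eqP (r0 _)) cards_eq0 => /eqP/setP/(_ t).
by rewrite !inE tT (negbTE nf) eqxx.
Qed.

Lemma F''_bpp (r : kvec Q k) : F'' r -> bpp r = false.
Proof.
by move=> /andP[_ /forallP r0]; apply/negbTE/existsPn => q; rewrite negbK.
Qed.

(** A vector in [F''] clears all flags one step later, and at a later vector in [F''] all flags are
    true; so the branch visits [F] in between. *)
Lemma tree_branch_final w rho (W : forall n, {set hist n}) p :
  kfinal w rho -> (forall n, tree w rho (W n)) -> (forall n, hist_of p n \in W n) ->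
  nba_final_path delta Q0 F w p.
Proof.
move=> [_ _ _ Frho] Wt pW; split; first split.
- by have /andP[/subsetP/(_ _ (pW 0))] := Wt 0.
- move=> i; have /and3P[_ /forallP/(_ (hist_of p i.+1))/implyP/(_ (pW i.+1)) + _] := Wt i.+1.
  by rewrite /= tip_hist_of.
move=> n; have [m [nm]] := Frho n; rewrite inE => Fm.
have [m' [mm']] := Frho m.+1; rewrite inE => Fm'.
have [||j mj pj] := @flag_visit (fun j => bpp (rho j)) p m.+1 m' mm'.
- by rewrite /= (F''_bpp Fm) andbF.
- exact: F''_flag Fm' (tree_counts (Wt m')) (pW m').
by exists j; split=> //; exact: leq_trans nm (ltnW mj).
Qed.

(** The section variables [P] list all final runs over [w] without repetition. *)
Section Runs.
Variables (w : nat -> Sigma) (m : nat) (P : 'I_m -> nat -> Q).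
Hypothesis m_le_k : m <= k.
Hypothesis P_inj : injective P.
Hypothesis P_final : forall i, nba_final_path delta Q0 F w (P i).
Hypothesis P_surj : forall p, nba_final_path delta Q0 F w p -> exists i, P i = p.

Definition img (S : {set 'I_m}) n : {set hist n} := [set hist_of (P i) n | i in S].

Definition realizes rho (S : {set 'I_m}) : Prop := forall n, tree w rho (img S n).

Lemma img_fst S n : [set t.1 | t in img S n.+1] = img S n.
Proof. by rewrite -imset_comp. Qed.

(** Two lifting arguments: [T] extends to a coherent sequence [W] of trees, as all step counts are
    nonzero, and each history in [W] extends to a branch of [W]. Such a branch is a final run, hence
    some [P i]; [S] collects the runs that stay in [W]. *)
Lemma tree_realized rho n (T : {set hist n}) : kfinal w rho -> tree w rho T ->
  exists2 S, realizes rho S & img S n = T.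
Proof.
move=> frho tT; have [_ _ kw _] := frho.
have [||W [Wt Wpi Wn]] := @inverse_system_thread (fun n => {set hist n})
    (fun n (T : {set hist n.+1}) => [set t.1 | t in T]) (fun n T => tree w rho T) _ _ n T tT.
- move=> j S tS; move: (kw j); rewrite -(card_tree_step tS) cards_eq0 => /set0Pn[S'].
  by rewrite inE => /andP[? /eqP ?]; exists S'.
- by move=> j S /and3P[].
pose S := [set i | `[< forall j, hist_of (P i) j \in W j >]].
have WS j : W j = img S j.
  apply/setP => t; apply/idP/imsetP => [tW|[i + ->]]; last by rewrite inE => /asboolP.
  have [||x [xW xpi xj]] := @inverse_system_thread (fun n => hist n : Type)
    (fun n (t : hist n.+1) => t.1) (fun n t => t \in W n) _ _ j t tW.
  - by move=> l a; rewrite -Wpi => /imsetP[a' ? ->]; exists a'.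
  - by move=> l a aW; rewrite -Wpi; apply: imset_f.
  have xp l : hist_of (fun l => tip (x l)) l = x l.
    by elim: l => //= l ->; rewrite -[x l]xpi; case: (x l.+1).
  have [i Pi] := P_surj (@tree_branch_final w rho W (fun l => tip (x l)) frho Wt
    (fun l => eq_ind_r (fun t => t \in W l) (xW l) (xp l))).
  exists i; last by rewrite Pi xp.
  by rewrite inE; apply/asboolP => l; rewrite Pi xp.
by exists S => [j|]; rewrite -WS.
Qed.

(** The vector at time n counts histories whose flags depend only on earlier vectors. *)
Lemma realizes_unique rho rho' S : realizes rho S -> realizes rho' S -> rho =1 rho'.
Proof.
move=> rS rS' n; elim/ltn_ind: n => n IHn; apply/ffunP => y; apply: val_inj.
have /tree_counts/forallP/(_ y)/eqP/= <- := rS n.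
have /tree_counts/forallP/(_ y)/eqP/= <- := rS' n.
apply: eq_card => t; rewrite !inE.
by rewrite (@eq_flag _ (fun j => bpp (rho' j))) // => j /IHn->.
Qed.

(** * The path determined by a set of runs *)

Section Realization.
Variable S : {set 'I_m}.

(* [run_flag n i] is the flag of run i at time n, computed without the vectors so that
   [realization] can be defined from it. *)
Fixpoint run_flag n : 'I_m -> bool :=
  match n with
  | 0 => fun=> false
  | n'.+1 => fun i =>
      ((P i n' \in F) || run_flag n' i) && [exists j in S, ~~ run_flag n' j]
  end.

Definition pending n := [exists j in S, ~~ run_flag n j].

Definition realization n : kvec Q k :=
  [ffun y => inord #|[set t in img S n | (tip t, flag pending t) == y]|].

Lemma run_flagE n i : run_flag n i = flag pending (hist_of (P i) n).
Proof. by elim: n i => //= n IHn i; rewrite -IHn tip_hist_of. Qed.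

(** [inord] does not truncate: distinct histories come from distinct runs, of which there are m <=
    k. *)
Lemma realizationE n y :
  realization n y = #|[set t in img S n | (tip t, flag pending t) == y]| :> nat.
Proof.
rewrite ffunE inordK // ltnS; apply: leq_trans m_le_k.
rewrite -[m in _ <= m]card_ord -cardsT; apply: leq_trans (leq_imset_card (fun i => hist_of (P i) n) _).
by apply/subset_leq_card/subsetP => t; rewrite inE => /andP[/imsetP[i _ ->] _]; apply: imset_f.
Qed.

Lemma bpp_realization n : bpp (realization n) = pending n.
Proof.
apply/existsP/existsP => [[q]|[i /andP[iS ni]]].
  rewrite realizationE cards_eq0 => /set0Pn[t]; rewrite !inE xpair_eqE => /and3P[].
  by move=> /imsetP[i iS ->] _; rewrite -run_flagE eqbF_neg => ?; exists i; rewrite iS.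
exists (P i n); rewrite realizationE cards_eq0; apply/set0Pn; exists (hist_of (P i) n).
by rewrite !inE imset_f //= tip_hist_of -run_flagE (negbTE ni) eqxx.
Qed.

Lemma realization_realizes : realizes realization S.
Proof.
have cr n : counts (fun j => bpp (realization j)) (img S n) (realization n).
  apply/forallP => y; rewrite realizationE; apply/eqP/eq_card => t; rewrite !inE.
  by rewrite (@eq_flag _ pending) // => j _; rewrite bpp_realization.
elim=> [|n IHn]; apply/andP; split.
- by apply/subsetP => _ /imsetP[i _ ->] /=; have [[]] := P_final i.
- exact: cr.
- by rewrite img_fst.
- apply/andP; split; last exact: (cr n.+1).
  apply/forallP => t; apply/implyP => /imsetP[i _ ->] /=; rewrite tip_hist_of.
  by have [[]] := P_final i.
Qed.

(** Otherwise some flag is false at every late time, so no reset happens and raised flags stay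
    raised. But each of the finitely many runs visits [F] again, after which all flags are true. *)
Lemma realization_inf_often : S != set0 -> inf_often [set r | F'' r] realization.
Proof.
move=> S0 N; apply: contrapT => nF.
have pend n : N <= n -> pending n.
  move=> Nn; apply: contrapT => /negP np; apply: nF; exists n; split=> //.
  rewrite inE /F''; apply/andP; split.
    rewrite inQ''_ksize -(card_tree_ksize (realization_realizes n)) card_gt0.
    by have /set0Pn[i iS] := S0; apply/set0Pn; exists (hist_of (P i) n); apply: imset_f.
  by move: np; rewrite -bpp_realization => /existsPn np; apply/forallP => q; have := np q; rewrite negbK.
have rf i j n : N <= j -> P i j \in F -> j < n -> run_flag n i.
  move=> Nj Pj /subnKC <-; elim: (n - j.+1) => [|d IHd].
    by rewrite addn0 /= Pj; exact: pend.
  have : N <= j.+1 + d by exact: leq_trans Nj (leq_trans (leqnSn _) (leq_addr _ _)).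
  by rewrite addnS; move: (j.+1 + d) IHd => e /= -> /pend pe; rewrite orbT.
have vis i : exists j, N <= j /\ P i j \in F by have [_] := P_final i; apply.
have [v vP] := fin_all_exists vis.
have := pend (maxn N (\max_i v i).+1) (leq_maxl _ _).
move=> /existsP[i /andP[_ /negP]]; apply; have [Nv Pv] := vP i.
by apply: rf Nv Pv _; rewrite leq_max ltnS (leq_bigmax (F := v) i) orbT.
Qed.

Lemma realization_kfinal : S != set0 -> kfinal w realization.
Proof.
move=> S0; split.
- rewrite inQ''_ksize -(card_tree_ksize (realization_realizes 0)) card_gt0.
  by have /set0Pn[i iS] := S0; apply/set0Pn; exists (hist_of (P i) 0); apply: imset_f.
- exact: alpha'_tree0 (realization_realizes 0).
- move=> n; rewrite -(card_tree_step (realization_realizes n)) cards_eq0.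
  apply/set0Pn; exists (img S n.+1); rewrite inE realization_realizes.
  by rewrite img_fst eqxx.
- exact: realization_inf_often.
Qed.

End Realization.

(** The product counts the trees of depth n, each the image of one of the 2^m sets of runs. *)
Lemma prod_kweight_le rho n : kfinal w rho ->
  \prod_(j < n) kweight delta F (rho j) (w j) (rho j.+1) <= 2 ^ m.
Proof.
move=> frho; have [_ a0 _ _] := frho; rewrite -card_tree //.
rewrite -[m in _ ^ m]card_ord -[2 ^ _]/(2 ^ #|'I_m|) -cardsT -card_powerset.
apply: leq_trans (leq_imset_card (fun S => img S n) _).
apply/subset_leq_card/subsetP => T; rewrite inE => /(tree_realized frho)[S _ <-].
by apply: imset_f; rewrite powersetE subsetT.
Qed.

Lemma hist_of_separated : exists N, forall n, N <= n -> injective (fun i => hist_of (P i) n).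
Proof.
have sep (ij : 'I_m * 'I_m) : exists N, forall n, N <= n ->
    hist_of (P ij.1) n = hist_of (P ij.2) n -> ij.1 = ij.2.
  case: ij => i j /=; have [->|/eqP nij] := eqVneq i j; first by exists 0.
  have [N PN] : exists N, P i N <> P j N.
    by apply: contrapT => nN; apply/nij/P_inj/funext => N; apply: contrapT => e; apply: nN; exists N.
  by exists N => n Nn /hist_of_eq/(_ N Nn).
have [v vP] := fin_all_exists sep.
exists (\max_ij v ij) => n le i j e; apply: (vP (i, j) n) => //.
exact: leq_trans (leq_bigmax (F := v) (i, j)) le.
Qed.

(** Past the separation time [S] is recovered from [img S n], so realizers and trees of depth n
    correspond and have equal cardinality. *)
Lemma card_realizers rho : kfinal w rho -> exists N, forall n, N <= n ->
  \prod_(j < n) kweight delta F (rho j) (w j) (rho j.+1) = #|[set S | `[< realizes rho S >]]|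
  /\ forall S, realizes rho S -> #|S| = ksize (rho n).
Proof.
move=> frho; have [_ a0 _ _] := frho; have [N NP] := hist_of_separated.
exists N => n /NP hI; split=> [|S rS]; last first.
  by rewrite -(card_tree_ksize (rS n)) card_imset.
rewrite -card_tree // -(card_imset _ (imset_inj hI)); apply: eq_card => T; rewrite inE.
apply/idP/imsetP => [/(tree_realized frho)[S rS <-]|[S + ->]].
  by exists S => //; rewrite inE; apply/asboolP.
by rewrite inE => /asboolP/(_ n).
Qed.

End Runs.
End Histories.

(** * Pumping, weights and acceptance *)

Section Rays.
Variables (V : finType) (e : rel V) (wt : V -> V -> nat) (f : V).
Hypothesis wt_gt0 : forall x y, e x y -> 0 < wt x y.

(** Will become a final path once letters are chosen; [B] bounds from below the product of counts on
    a prefix. *)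
Definition ray x B : Prop := exists z : nat -> V,
  [/\ z 0 = x, forall i, e (z i) (z i.+1), inf_often [set f] z
    & exists n, B <= \prod_(j < n) wt (z j) (z j.+1)].

Lemma ray_cycle g : e f g -> connect e g f -> ray f 1.
Proof.
move=> efg /connectP[p gp fp]; pose c := g :: p; pose s := size c.
have fc : path e f c by rewrite /= efg.
(* [f :: c] has s + 1 entries and both ends are [f], so indices modulo s go round the cycle. *)
pose z i := nth f (f :: c) (i %% s).
exists z; split=> //.
- move=> i; have ltm : i %% s < s by rewrite ltn_mod.
  have -> : z i.+1 = nth f c (i %% s); last exact: (pathP f fc).
  rewrite /z -addn1 -modnDml addn1.
  move: ltm; rewrite leq_eqVlt => /predU1P[im|ltm]; last by rewrite modn_small.
  have -> : i %% s = size p by case: im.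
  by rewrite modnn /= [LHS]fp (last_nth f).
- move=> n; exists (n * s); split; first by rewrite leq_pmulr.
  by rewrite inE /z modnMl.
- by exists 0; rewrite big_ord0.
Qed.

Lemma ray_cons x y B : e x y -> ray y B -> ray x (wt x y * B).
Proof.
move=> exy [z [z0 ze zf [n nB]]]; exists (fun i => if i is j.+1 then z j else x).
split=> //; first by case=> [|i] //; rewrite z0.
  by move=> N; have [m [Nm zm]] := zf N; exists m.+1; split=> //; apply: leqW.
by exists n.+1; rewrite big_ord_recl /= z0 leq_mul.
Qed.

Lemma ray_connect x y B : connect e x y -> ray y B -> ray x B.
Proof.
move=> /connectP[p]; elim: p x => [|v p IHp] x /=; first by move=> _ ->.
move=> /andP[exv vp] ly /(IHp _ vp ly)/(ray_cons exv)[z [z0 ze zf [n nB]]].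
by exists z; split=> //; exists n; apply: leq_trans nB; rewrite leq_pmull ?wt_gt0.
Qed.

(** Each turn from [y] back to [x] and over the edge to [y] contributes a factor of at least 2. *)
Lemma ray_pump x y n : e x y -> 1 < wt x y -> connect e y x -> ray y 1 -> ray y (2 ^ n).
Proof.
move=> exy wxy yx y1; elim: n => // n /(ray_cons exy)/(ray_connect yx)[z [z0 ze zf [l lB]]].
exists z; split=> //; exists l; apply: leq_trans lB.
by rewrite expnS leq_mul2r wxy orbT.
Qed.

End Rays.

(** * Transitions on cycles and ultimate stability *)

Section Kdis.
Variables (Q Sigma : finType) (delta : Q -> Sigma -> {set Q}) (Q0 F : {set Q}) (k : nat).
Hypothesis k_gt0 : 0 < k.
Hypothesis amb : k_ambiguous delta Q0 F k.

Local Notation kedge := (@kedge Q Sigma delta F k).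
Local Notation kweight := (@kweight Q Sigma delta F k).
Local Notation Delta'' := (@Delta'' Q Sigma delta F k).

Lemma Delta''_neq0 a r r' : (Delta'' a r r' != 0%R) = (kweight r a r' != 0).
Proof. by rewrite mulf_eq0 expfz_eq0 andbF pnatr_eq0. Qed.

Lemma kedgeE r r' : kedge r r' = [&& inQ'' r, inQ'' r' & [exists a, kweight r a r' != 0]].
Proof. by rewrite /kedge; do 2!congr andb; apply: eq_existsb => a; rewrite Delta''_neq0. Qed.

Lemma kweight_cycle r a r' : kreachable delta Q0 F r -> kcoreachable delta F r' ->
  inQ'' r' -> kweight r a r' != 0 -> connect kedge r' r ->
  kweight r a r' = 1 /\ ksize r = ksize r'.
Proof.
move=> /andP[rQ /existsP[r0 /and3P[r0Q a0 r0r]]] /existsP[f /and3P[Ff r'f /existsP[g /andP[fg gf]]]].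
move=> r'Q rr' r'r.
have conn_le x y : connect kedge x y -> ksize x <= ksize y.
  move=> /connectP[p]; elim: p x => [|v p IHp] x /=; first by move=> _ ->.
  rewrite kedgeE => /andP[/and3P[_ _ /existsP[b xv]] vp] /(IHp _ vp).
  exact/leq_trans/(ksize_le k_gt0 xv).
split; last by apply/eqP; rewrite eqn_leq (conn_le _ _ r'r) (ksize_le k_gt0 rr').
(* Edges carry no letter, so the best letter is taken; the word [w] then reads a maximizing letter
   at each step. *)
pose wt x y := \max_(b : Sigma) kweight x b y.
have wt_gt0 x y : kedge x y -> 0 < wt x y.
  rewrite kedgeE => /and3P[_ _ /existsP[b xy]].
  by apply: leq_trans (leq_bigmax (F := fun b => kweight x b y) b); rewrite lt0n.
have err' : kedge r r' by rewrite kedgeE rQ r'Q; apply/existsP; exists a.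
apply/eqP; rewrite eqn_leq lt0n rr' andbT leqNgt; apply/negP => lt1.
have lt1w : 1 < wt r r'.
  exact: leq_trans lt1 (leq_bigmax (F := fun b => kweight r b r') a).
have [z [z0 ze zf [n nB]]] : ray kedge wt f r0 (2 ^ k.+1).
  apply: (ray_connect wt_gt0 (connect_trans r0r (connect1 err'))).
  apply: (ray_pump wt_gt0 _ err' lt1w r'r).
  exact: (ray_connect wt_gt0 r'f (ray_cycle wt fg gf)).
have ltr i : exists b, wt (z i) (z i.+1) = kweight (z i) b (z i.+1).
  rewrite /wt; have [|b ->] := @bigop.eq_bigmax _ (fun b => kweight (z i) b (z i.+1)); last by exists b.
  by apply/card_gt0P; exists a.
have [w wP] := choice ltr.
have zfin : kfinal delta Q0 F w z.
  split; rewrite ?z0 //; first by move=> i; rewrite -lt0n -wP wt_gt0.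
  by move=> N; have [m [Nm /set1P zm]] := zf N; exists m; split=> //; rewrite inE zm.
have [m [P [mk PI PF PS]]] := at_most_enum (@amb w).
have := prod_kweight_le k_gt0 PS n zfin; under eq_bigr => j _ do rewrite -wP.
move=> /(leq_trans nB); rewrite leq_exp2l // => /leq_trans/(_ mk).
by rewrite ltnn.
Qed.

Local Notation kstate := (@kstate Q Sigma delta Q0 F k).
Local Notation M := (kdis_M delta Q0 F k).
Local Notation alpha := (kdis_alpha delta Q0 F k).
Local Notation FF := (kdis_F delta Q0 F k).

Lemma kstate_inQ'' (s : kstate) : inQ'' (val s).
Proof. by have /andP[/andP[]] := valP s. Qed.

Lemma Mword_connect u (s s' : kstate) : Mword M u s s' != 0%R -> connect kedge (val s) (val s').
Proof.
elim: u s => [|a u IHu] s /=.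
  by rewrite /mid pnatr_eq0 eqb0 negbK => /eqP->.
rewrite /mmul => nz; have [s1] : exists s1, (M a s s1 * Mword M u s1 s')%R != 0%R.
  apply/existsP; apply: contraR nz => /existsPn nz; apply/eqP/big1 => s1 _.
  by apply/eqP; have := nz s1; rewrite negbK.
rewrite mulf_eq0 negb_or => /andP[ss1 /IHu]; apply/connect_trans/connect1.
by rewrite /kedge !kstate_inQ''; apply/existsP; exists a.
Qed.

Lemma kdis_ultimately_stable : ultimately_stable M.
Proof.
move=> s s' a [u /Mword_connect s's].
have [->|nz] := eqVneq (M a s s') 0%R; [by left|right].
have /andP[rs _] := valP s; have /andP[_ cs'] := valP s'.
have [|w1 es] := kweight_cycle (a := a) rs cs' (kstate_inQ'' s') _ s's.
  by rewrite -Delta''_neq0.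
by rewrite /kdis_M /Defs.Delta'' w1 es subrr expr0z mulr1.
Qed.

(** * Final paths of kdis over one word and their weights *)

Section Word.
Variable w : nat -> Sigma.
Implicit Types rho : nat -> kvec Q k.

Lemma kfinal_connect rho n n' : kfinal delta Q0 F w rho -> n <= n' ->
  connect kedge (rho n) (rho n').
Proof.
move=> fr /subnKC <-; elim: (n' - n) => [|d IHd]; first by rewrite addn0 connect0.
apply: connect_trans IHd (connect1 _); rewrite addnS kedgeE !(kfinal_inQ'' k_gt0 _ fr).
by apply/existsP; exists (w (n + d)); case: fr.
Qed.

(** A vector of [F''] that recurs infinitely often lies on a cycle reachable from every position, so
    trimming keeps the whole path. *)
Lemma kfinal_kkeep rho n : kfinal delta Q0 F w rho -> kkeep delta Q0 F (rho n).
Proof.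
move=> fr; have [q0 a0 kw Fr] := fr; apply/andP; split.
  rewrite /kreachable (kfinal_inQ'' k_gt0 _ fr); apply/existsP; exists (rho 0).
  by rewrite q0 a0 kfinal_connect.
have [f] := inf_often_point Fr; rewrite inE => Ff fo; apply/existsP; exists f; rewrite Ff /=.
have [m [nm /set1P em]] := fo n; have [m' [mm' /set1P em']] := fo m.+1.
apply/andP; split; first by rewrite -em kfinal_connect.
apply/existsP; exists (rho m.+1); rewrite -{2}em' kfinal_connect // andbT -em kedgeE.
by rewrite !(kfinal_inQ'' k_gt0 _ fr); apply/existsP; exists (w m).
Qed.

Lemma kfinal_lift rho : kfinal delta Q0 F w rho ->
  exists2 s : nat -> kstate, (forall n, val (s n) = rho n) & wfinal_path M alpha FF w s.
Proof.
move=> fr; exists (fun n => exist _ (rho n) (kfinal_kkeep n fr)) => //.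
have [q0 a0 kw Fr] := fr; split; first by split=> // i; rewrite Delta''_neq0; apply: kw.
by move=> N; have [m [Nm]] := Fr N; rewrite inE => Fm; exists m; rewrite inE.
Qed.

Lemma wfinal_kfinal (s : nat -> kstate) : wfinal_path M alpha FF w s ->
  kfinal delta Q0 F w (fun n => val (s n)).
Proof.
move=> [[a0 sM] sF]; split=> //; first exact: kstate_inQ''.
  by move=> i; rewrite -Delta''_neq0; apply: sM.
by move=> N; have [m [Nm]] := sF N; rewrite inE => Fm; exists m; rewrite inE.
Qed.

(** Signs telescope: each intermediate size occurs in two consecutive factors, leaving the last size
    and the -1 from the exponent in [alpha']. *)
Lemma alpha'_prod_Delta'' (rho : nat -> kvec Q k) n : inQ'' (rho 0) -> alpha' Q0 (rho 0) != 0%R ->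
  (alpha' Q0 (rho 0) * \prod_(j < n) Delta'' (w j) (rho j) (rho j.+1) =
   - ((\prod_(j < n) kweight (rho j) (w j) (rho j.+1))%:R * (-1) ^+ ksize (rho n)))%R.
Proof.
move=> q0; rewrite {1 2}/alpha'; case: ifP => [_ _|_]; last by rewrite eqxx.
rewrite (exprN1z_sub _ 1) expr1 mulrN1.
elim: n => [|n IHn]; first by rewrite !big_ord0 mulr1 mul1r.
rewrite !big_ord_recr /= mulrA IHn natrM /Defs.Delta'' exprN1z_sub !mulNr; congr (- _)%R.
set x := (_ %:R)%R; set y := (_ %:R)%R; set u := (_ ^+ _)%R; set v := (_ ^+ _)%R.
have -> : (x * u * (v * u * y) = (x * y * v) * (u * u))%R.
  by rewrite -!mulrA; congr (_ * _)%R; rewrite mulrCA [(y * _)%R]mulrC -!mulrA; congr (_ * _)%R; rewrite mulrCA.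
by rewrite -expr2 sqrr_sign mulr1.
Qed.

Variables (m : nat) (P : 'I_m -> nat -> Q).
Hypothesis m_le_k : m <= k.
Hypothesis P_inj : injective P.
Hypothesis P_final : forall i, nba_final_path delta Q0 F w (P i).
Hypothesis P_surj : forall p, nba_final_path delta Q0 F w p -> exists i, P i = p.

Local Notation realizes := (@realizes Q Sigma delta Q0 F k w m P).

Lemma kfinal_realized rho : kfinal delta Q0 F w rho -> exists S, realizes rho S.
Proof.
move=> fr; have [_ a0 _ _] := fr; have := card_tree delta F k_gt0 w 0 a0.
rewrite big_ord0 => /eqP/cards1P[T /setP/(_ T)]; rewrite !inE eqxx => tT.
by have [S rS _] := tree_realized k_gt0 P_surj fr tT; exists S.
Qed.

Lemma realizes_neq0 rho S : kfinal delta Q0 F w rho -> realizes rho S -> S != set0.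
Proof.
move=> [q0 _ _ _] rS; apply: contraTneq q0 => S0.
by rewrite inQ''_ksize -(card_tree_ksize (rS 0)) S0 /img imset0 cards0.
Qed.

(** Choosing a realizer for each path is injective, and there are 2^m <= 2^k sets of runs. *)
Lemma kdis_at_most : at_most (2 ^ k) (wfinal_path M alpha FF w).
Proof.
move=> f fP; have [S SP] := fin_all_exists (fun i => kfinal_realized (wfinal_kfinal (fP i))).
have /injectivePn[i [j nij Sij]] : ~~ injectiveb S.
  apply/negP => /injectiveP/leq_card; apply/negP.
  by rewrite -ltnNge card_ord ltnS -cardsT -powersetT card_powerset cardsT card_ord leq_exp2l.
exists i, j; split=> //; apply/funext => n; apply: val_inj.
apply: (realizes_unique (w := w) (P := P) (S := S i) (rho := fun n => val (f i n)) (rho' := fun n => val (f j n))) => //.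
by rewrite Sij.
Qed.

(** The partial products are eventually constant: the counts multiply to the number of realizers,
    all of whose cardinalities equal the current size. *)
Lemma weight_realizers (s : nat -> kstate) : wfinal_path M alpha FF w s ->
  weight_is M alpha w s (\sum_(S | `[< realizes (fun n => val (s n)) S >]) - (-1) ^+ #|S|)%R.
Proof.
move=> /wfinal_kfinal fs; have [q0 a0 _ _] := fs.
set c := (\sum_(S | _) _)%R; exists (c / alpha (s 0))%R.
split; last by rewrite mulrC divfK.
have [N NP] := card_realizers k_gt0 P_inj P_surj fs.
(* [leqW] because the n-th partial product has n + 1 factors. *)
move=> eps eps_gt0; exists N => n Nn; have [en cn] := NP _ (leqW Nn).
suff -> : (\prod_(j < n.+1) M (w j) (s j) (s j.+1) = c / alpha (s 0))%R by rewrite subrr normr0.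
apply: (mulfI a0); rewrite [RHS]mulrC divfK // [LHS](alpha'_prod_Delta'' (rho := fun j => val (s j)) n.+1 q0 a0) en.
rewrite /c (eq_bigr (fun=> - (-1) ^+ ksize (val (s n.+1))))%R; last first.
  by move=> S /asboolP/cn->.
rewrite sumr_const mulNrn mulr_natl; congr (- (_ *+ _))%R.
by apply: eq_card => S; rewrite inE.
Qed.

Lemma kdis_L_is : L_is M alpha FF w (0 < m)%:R%R.
Proof.
have [n [s [_ sI sF sS]]] := at_most_enum kdis_at_most.
exists n, s, (fun i => \sum_(S | `[< realizes (fun n => val (s i n)) S >]) - (-1) ^+ #|S|)%R.
split=> //; split=> //; split=> //; split; first by move=> i; apply: weight_realizers.
(* Sum over sets of runs first: each nonempty [S] is realized by exactly one listed path, the empty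
   set by none. *)
rewrite (exchange_big_dep (fun S => S != set0)) /=; last first.
  by move=> i S _ /asboolP/realizes_neq0; apply; apply: wfinal_kfinal.
rewrite (eq_bigr (fun S : {set 'I_m} => - (-1) ^+ #|S|)%R) => [|S S0].
  (* The full alternating sum is 1 for m = 0 and 0 otherwise; the empty set accounts for a term 1 of
     it. *)
  have := sum_signr_card rat 'I_m; rewrite (bigD1 set0) //= cards0 expr0 card_ord => e.
  by rewrite sumrN -[X in (- X)%R](addKr 1%R) e opprD opprK lt0n; case: eqP => _; rewrite ?subrr ?subr0.
have [t ts tf] := kfinal_lift (realization_kfinal k_gt0 m_le_k P_final S0).
have [i si] := sS _ tf.
rewrite (big_pred1 i) // => j; apply/asboolP/eqP => [rj|->].
  apply: sI; rewrite si; apply/funext => l; apply: val_inj; rewrite ts.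
  have rS := realization_realizes m_le_k P_final S.
  exact (realizes_unique rj rS l).
move=> l; have -> : (fun l => val (s i l)) = realization F k P S by apply/funext => l'; rewrite si.
exact: realization_realizes.
Qed.

End Word.

End Kdis.

Theorem theorem4 (Q Sigma : finType) (delta : Q -> Sigma -> {set Q})
    (Q0 F : {set Q}) (k : nat) :
  (1 <= k)%N ->
  k_ambiguous delta Q0 F k ->
  IBA (kdis_M delta Q0 F k) (kdis_alpha delta Q0 F k) (kdis_F delta Q0 F k) /\
  (forall w : nat -> Sigma,
     wba_accepts (kdis_M delta Q0 F k) (kdis_alpha delta Q0 F k)
                 (kdis_F delta Q0 F k) w
     <-> exists p : nat -> Q, nba_final_path delta Q0 F w p).
Proof.
move=> k_gt0 amb; split; first split; [|split=> [|w]|move=> w].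
- exact: kdis_ultimately_stable.
- exists (2 ^ k) => w; have [m [P [mk PI PF PS]]] := at_most_enum (amb w).
  exact: (kdis_at_most k_gt0 mk PS).
- have [m [P [mk PI PF PS]]] := at_most_enum (amb w).
  exists (0 < m)%:R%R; split; first exact: (kdis_L_is k_gt0 mk PI PF PS).
  by case: m {P mk PI PF PS} => [|m]; [left|right].
have [m [P [mk PI PF PS]]] := at_most_enum (amb w); split=> [|[p /PS[i _]]].
  (* An empty sum would be 0, so acceptance supplies a final path of kdis, and its nonempty realizer
     contains a final run. *)
  move=> [n [s [c [_ [sF [_ [_]]]]]]]; case: n s c sF => [|n] s c sF.
    by rewrite big_ord0 => /eqP; rewrite oner_eq0.
  move=> _; have fs := wfinal_kfinal (sF ord0).
  have [S rS] := kfinal_realized k_gt0 PS fs.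
  have /set0Pn[i _] := realizes_neq0 fs rS.
  by exists (P i).
have := kdis_L_is k_gt0 mk PI PF PS.
by rewrite (leq_ltn_trans (leq0n i) (ltn_ord i)).
Qed.
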